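(* Let $\mathcal V$ be a closed symmetric monoidal category with an initial object. Then the canonical morphism $\phi^{\mathcal V}\colon \mathtt{Ass}^{\mathcal V}\to\mathtt{uAss}^{\mathcal V}$ from the associative operad to the unital associative operad is an epimorphism in the category $\mathrm{Op}(\mathcal V)$ of non-symmetric operads in $\mathcal V$.
   Context: Let $\mathcal V$ be a symmetric monoidal category with tensor product $\otimes$ and tensor unit $\mathbb I$. A (non-symmetric) operad $\mathcal O$ in $\mathcal V$ is a sequence $\{\mathcal O(n)\}_{n\ge 0}$ of objects of $\mathcal V$ with an identity $\mathrm{id}_{\mathcal O}\colon\mathbb I\to\mathcal O(1)$ and composition laws $\circ_i\colon\mathcal O(p)\otimes\mathcal O(q)\to\mathcal O(p+q-1)$, $1\le i\le p$, $q\ge 0$, satisfying the following equations (written with elements; in general they are expressed by commutative diagrams in $\mathcal V$): (1) $(a\circ_i b)\circ_j c=(a\circ_j c)\circ_{i+q-1}b$ if $1\le j<i$ and $c\in\mathcal O(q)$; (2) $(a\circ_i b)\circ_j c=a\circ_i(b\circ_{j-i+1}c)$ if $b\in\mathcal O(p)$ and $i\le j<p+i$; (3) $\mathrm{id}_{\mathcal O}\circ_1 a=a$; (4) $a\circ_i\mathrm{id}_{\mathcal O}=a$. A morphism of operads is a sequence of morphisms $\mathcal O(n)\to\mathcal P(n)$, $n\geq 0$, compatible with identities and composition laws. The unital associative operad $\mathtt{uAss}^{\mathcal V}$ has $\mathtt{uAss}^{\mathcal V}(n)=\mathbb I$ for all $n\ge 0$, identity the identity morphism of $\mathbb I$, and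 all composition laws given by the unit isomorphism $\mathbb I\otimes\mathbb I\cong\mathbb I$. If $\mathcal V$ is closed with initial object $\varnothing$, the associative operad $\mathtt{Ass}^{\mathcal V}$ has $\mathtt{Ass}^{\mathcal V}(n)=\mathbb I$ for $n\ge 1$ and $\mathtt{Ass}^{\mathcal V}(0)=\varnothing$; its operad structure is the one for which the sequence of morphisms $\phi^{\mathcal V}\colon\mathtt{Ass}^{\mathcal V}\to\mathtt{uAss}^{\mathcal V}$, with $\phi^{\mathcal V}(n)=\mathrm{id}_{\mathbb I}$ for $n\ge1$, is a morphism of operads. *)

(* Defs.v *)
From mathcomp Require Import all_boot zify.
From Stdlib Require Import FunctionalExtensionality ProofIrrelevance.

Set Implicit Arguments.
Unset Strict Implicit.
Unset Printing Implicit Defensive.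
#[local] Obligation Tactic := idtac.

Declare Scope cat_scope.
Delimit Scope cat_scope with cat.
Local Open Scope cat_scope.

Reserved Notation "A ⟶ B" (at level 90, right associativity).
Reserved Notation "g ∘ f" (at level 40, left associativity).
Reserved Notation "A ⊗ B" (at level 37, left associativity).
Reserved Notation "f ⊠ g" (at level 37, left associativity).

Record category := Category {
  obj :> Type;
  hom : obj -> obj -> Type;
  idm : forall A, hom A A;
  cmp : forall A B C, hom B C -> hom A B -> hom A C;
  cmp_idl : forall A B (f : hom A B), cmp (idm B) f = f;
  cmp_idr : forall A B (f : hom A B), cmp f (idm A) = f;
  cmp_assoc : forall A B C D (h : hom C D) (g : hom B C) (f : hom A B),
    cmp h (cmp g f) = cmp (cmp h g) f }.

Arguments idm {c} A.

Notation "A ⟶ B" := (hom A B) : cat_scope.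
Notation "g ∘ f" := (cmp g f) : cat_scope.

Definition epimorphism (C : category) (A B : C) (f : A ⟶ B) : Prop :=
  forall (X : C) (g h : B ⟶ X), g ∘ f = h ∘ f -> g = h.

Record initial_object (C : category) := InitialObject {
  init :> obj C;
  init_map : forall A : C, init ⟶ A;
  init_uniq : forall (A : C) (f : init ⟶ A), f = init_map A }.

Record monoidal_category := MonoidalCategory {
  mcat :> category;
  munit : mcat;
  tens : mcat -> mcat -> mcat;
  tensm : forall A B A' B' : mcat,
    (A ⟶ A') -> (B ⟶ B') -> (tens A B ⟶ tens A' B');
  massoc : forall A B C : mcat, tens (tens A B) C ⟶ tens A (tens B C);
  massocV : forall A B C : mcat, tens A (tens B C) ⟶ tens (tens A B) C;
  lunit : forall A : mcat, tens munit A ⟶ A;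
  lunitV : forall A : mcat, A ⟶ tens munit A;
  runit : forall A : mcat, tens A munit ⟶ A;
  runitV : forall A : mcat, A ⟶ tens A munit;
  tensm_id : forall A B : mcat, tensm (idm A) (idm B) = idm (tens A B);
  tensm_cmp : forall (A B C A' B' C' : mcat) (g : B ⟶ C) (f : A ⟶ B)
      (g' : B' ⟶ C') (f' : A' ⟶ B'),
    tensm (g ∘ f) (g' ∘ f') = tensm g g' ∘ tensm f f';
  massocK : forall A B C : mcat, massocV A B C ∘ massoc A B C = idm _;
  massocVK : forall A B C : mcat, massoc A B C ∘ massocV A B C = idm _;
  lunitK : forall A : mcat, lunitV A ∘ lunit A = idm _;
  lunitVK : forall A : mcat, lunit A ∘ lunitV A = idm _;
  runitK : forall A : mcat, runitV A ∘ runit A = idm _;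
  runitVK : forall A : mcat, runit A ∘ runitV A = idm _;
  massoc_nat : forall (A B C A' B' C' : mcat)
      (f : A ⟶ A') (g : B ⟶ B') (h : C ⟶ C'),
    massoc A' B' C' ∘ tensm (tensm f g) h
    = tensm f (tensm g h) ∘ massoc A B C;
  lunit_nat : forall (A B : mcat) (f : A ⟶ B),
    lunit B ∘ tensm (idm munit) f = f ∘ lunit A;
  runit_nat : forall (A B : mcat) (f : A ⟶ B),
    runit B ∘ tensm f (idm munit) = f ∘ runit A;
  triangle : forall A B : mcat,
    tensm (idm A) (lunit B) ∘ massoc A munit B = tensm (runit A) (idm B);
  pentagon : forall A B C D : mcat,
    massoc A B (tens C D) ∘ massoc (tens A B) C D
    = tensm (idm A) (massoc B C D) ∘ massoc A (tens B C) D
      ∘ tensm (massoc A B C) (idm D) }.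

Arguments munit {m}.

Notation "A ⊗ B" := (tens A B) : cat_scope.
Notation "f ⊠ g" := (tensm f g) : cat_scope.

Record symmetric_monoidal_category := SymmetricMonoidalCategory {
  smcat :> monoidal_category;
  sym : forall A B : smcat, A ⊗ B ⟶ B ⊗ A;
  sym_nat : forall (A B A' B' : smcat) (f : A ⟶ A') (g : B ⟶ B'),
    sym A' B' ∘ (f ⊠ g) = (g ⊠ f) ∘ sym A B;
  symK : forall A B : smcat, sym B A ∘ sym A B = idm _;
  hexagon : forall A B C : smcat,
    massoc B C A ∘ sym A (B ⊗ C) ∘ massoc A B C
    = (idm B ⊠ sym A C) ∘ massoc B A C ∘ (sym A B ⊠ idm C) }.

Record closed_symmetric_monoidal_category := ClosedSymmetricMonoidalCategory {
  csmcat :> symmetric_monoidal_category;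
  ihom : csmcat -> csmcat -> csmcat;
  ev : forall B C : csmcat, ihom B C ⊗ B ⟶ C;
  curry : forall A B C : csmcat, (A ⊗ B ⟶ C) -> (A ⟶ ihom B C);
  curryK : forall (A B C : csmcat) (f : A ⊗ B ⟶ C),
    ev B C ∘ (curry f ⊠ idm B) = f;
  curry_uniq : forall (A B C : csmcat) (f : A ⊗ B ⟶ C) (g : A ⟶ ihom B C),
    ev B C ∘ (g ⊠ idm B) = f -> g = curry f }.

(* Arities such as [(p + r - 1) + q - 1] and [(p + q - 1) + r - 1] are provably
   but not definitionally equal; [arity_cast] is the identity morphism between
   the corresponding objects. *)
Definition arity_cast (C : category) (O : nat -> C) m n (e : m = n) :
    O m ⟶ O n :=
  match e in _ = k return O m ⟶ O k with erefl => idm (O m) end.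
Arguments arity_cast {C} O {m n} e.

(* The operation [a ∘_i b] is [ocomp O p q i _ : O p ⊗ O q ⟶ O (p + q - 1)].
   In [ocomp_par] and [ocomp_seq], the range of [i] is [h1] and that of [j] is
   the last hypothesis; the other range conditions and the equation [e] follow
   from these two and have unique proofs, so quantifying over them only names
   these proofs. *)
Record operad (V : symmetric_monoidal_category) := Operad {
  oobj :> nat -> V;
  oid : munit ⟶ oobj 1;
  ocomp : forall p q i : nat, 1 <= i <= p ->
    oobj p ⊗ oobj q ⟶ oobj (p + q - 1);
  (* (a ∘_i b) ∘_j c = (a ∘_j c) ∘_{i+q-1} b *)
  ocomp_par : forall (p r q i j : nat)
      (h1 : 1 <= i <= p) (h2 : 1 <= j <= p + r - 1)
      (h3 : 1 <= j <= p) (h4 : 1 <= i + q - 1 <= p + q - 1)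
      (e : (p + q - 1) + r - 1 = (p + r - 1) + q - 1),
    1 <= j < i ->
    ocomp q h2 ∘ (ocomp r h1 ⊠ idm (oobj q))
    = arity_cast oobj e ∘ ocomp r h4 ∘ (ocomp q h3 ⊠ idm (oobj r))
      ∘ massocV (oobj p) (oobj q) (oobj r)
      ∘ (idm (oobj p) ⊠ sym (oobj r) (oobj q))
      ∘ massoc (oobj p) (oobj r) (oobj q);
  (* (a ∘_i b) ∘_j c = a ∘_i (b ∘_{j-i+1} c) *)
  ocomp_seq : forall (m p q i j : nat)
      (h1 : 1 <= i <= m) (h2 : 1 <= j <= m + p - 1)
      (h3 : 1 <= j - i + 1 <= p)
      (e : m + (p + q - 1) - 1 = (m + p - 1) + q - 1),
    i <= j < p + i ->
    ocomp q h2 ∘ (ocomp p h1 ⊠ idm (oobj q))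
    = arity_cast oobj e ∘ ocomp (p + q - 1) h1
      ∘ (idm (oobj m) ⊠ ocomp q h3)
      ∘ massoc (oobj m) (oobj p) (oobj q);
  (* id ∘_1 a = a *)
  ocomp_idl : forall (n : nat) (h : 1 <= 1 <= 1) (e : 1 + n - 1 = n),
    arity_cast oobj e ∘ ocomp n h ∘ (oid ⊠ idm (oobj n)) = lunit (oobj n);
  (* a ∘_i id = a *)
  ocomp_idr : forall (p i : nat) (h : 1 <= i <= p) (e : p + 1 - 1 = p),
    arity_cast oobj e ∘ ocomp 1 h ∘ (idm (oobj p) ⊠ oid) = runit (oobj p) }.

Arguments oid {V} o.
Arguments ocomp {V} o {p} q {i} _.

Record operad_hom (V : symmetric_monoidal_category) (O P : operad V) :=
  OperadHom {
  ohom :> forall n : nat, O n ⟶ P n;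
  ohom_id : ohom 1 ∘ oid O = oid P;
  ohom_comp : forall (p q i : nat) (h : 1 <= i <= p),
    ohom (p + q - 1) ∘ ocomp O q h = ocomp P q h ∘ (ohom p ⊠ ohom q) }.

Lemma operad_hom_eq (V : symmetric_monoidal_category) (O P : operad V)
  (f g : operad_hom O P) : (forall n, f n = g n) -> f = g.
Proof.
case: f g => [f f1 f2] [g g1 g2] /= fg.
have efg : f = g by apply: functional_extensionality_dep.
by case: g / efg g1 g2 {fg} => g1 g2; congr OperadHom; apply: proof_irrelevance.
Qed.

Section OperadCategory.
Variable V : symmetric_monoidal_category.

Program Definition operad_hom_idm (O : operad V) : operad_hom O O :=
  @OperadHom V O O (fun n => idm (O n)) _ _.
Next Obligation. by move=> O; rewrite cmp_idl. Qed.
Next Obligation. by move=> O p q i h; rewrite cmp_idl tensm_id cmp_idr. Qed.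

Program Definition operad_hom_cmp (O P Q : operad V)
    (g : operad_hom P Q) (f : operad_hom O P) : operad_hom O Q :=
  @OperadHom V O Q (fun n => g n ∘ f n) _ _.
Next Obligation. by move=> O P Q g f; rewrite -cmp_assoc !ohom_id. Qed.
Next Obligation.
move=> O P Q g f p q i h.
by rewrite -cmp_assoc ohom_comp cmp_assoc ohom_comp -cmp_assoc tensm_cmp.
Qed.

Program Definition Op : category :=
  @Category (operad V) (@operad_hom V) operad_hom_idm operad_hom_cmp _ _ _.
Next Obligation.
by move=> O P f; apply: operad_hom_eq => n /=; rewrite cmp_idl.
Qed.
Next Obligation.
by move=> O P f; apply: operad_hom_eq => n /=; rewrite cmp_idr.
Qed.
Next Obligation.
by move=> O P Q R h g f; apply: operad_hom_eq => n /=; rewrite cmp_assoc.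
Qed.

End OperadCategory.

Section MonoidalFacts.
Variable V : monoidal_category.
Implicit Types A B C D : V.

Lemma tensm_cmpl A B C D (g : B ⟶ C) (f : A ⟶ B) :
  (g ∘ f) ⊠ idm D = (g ⊠ idm D) ∘ (f ⊠ idm D).
Proof. by rewrite -tensm_cmp cmp_idl. Qed.

Lemma tensm_cmpr A B C D (g : B ⟶ C) (f : A ⟶ B) :
  idm D ⊠ (g ∘ f) = (idm D ⊠ g) ∘ (idm D ⊠ f).
Proof. by rewrite -tensm_cmp cmp_idl. Qed.

Lemma lunit_inj A B (f g : A ⟶ B) :
  idm (@munit V) ⊠ f = idm munit ⊠ g -> f = g.
Proof.
move=> fg; rewrite -(cmp_idr f) -(cmp_idr g) -(lunitVK A) !cmp_assoc.
by rewrite -!lunit_nat fg.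
Qed.

Lemma runit_inj A B (f g : A ⟶ B) :
  f ⊠ idm (@munit V) = g ⊠ idm munit -> f = g.
Proof.
move=> fg; rewrite -(cmp_idr f) -(cmp_idr g) -(runitVK A) !cmp_assoc.
by rewrite -!runit_nat fg.
Qed.

Lemma lunit_tensI A : lunit (munit ⊗ A) = idm munit ⊠ lunit A.
Proof.
rewrite -[LHS]cmp_idl -[RHS]cmp_idl -(lunitK A) -!cmp_assoc.
by congr cmp; rewrite lunit_nat.
Qed.

Lemma lunit_tens A B :
  lunit (A ⊗ B) ∘ massoc munit A B = lunit A ⊠ idm B.
Proof.
apply: lunit_inj; rewrite tensm_cmpr.
rewrite -[LHS]cmp_idr -[RHS]cmp_idr -(massocVK munit (munit ⊗ A) B).
rewrite !cmp_assoc; congr cmp.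
have isoV : (massoc munit munit A ⊠ idm B) ∘ (massocV munit munit A ⊠ idm B)
    = idm _ by rewrite -tensm_cmpl massocVK tensm_id.
rewrite -[LHS]cmp_idr -[RHS]cmp_idr -isoV !cmp_assoc; congr cmp.
have -> : (idm munit ⊠ lunit (A ⊗ B)) ∘ (idm munit ⊠ massoc munit A B)
    ∘ massoc munit (munit ⊗ A) B ∘ (massoc munit munit A ⊠ idm B)
  = (idm munit ⊠ lunit (A ⊗ B)) ∘ massoc munit munit (A ⊗ B)
    ∘ massoc (munit ⊗ munit) A B.
  by rewrite -!cmp_assoc pentagon -!cmp_assoc.
rewrite triangle -massoc_nat -cmp_assoc -tensm_cmpl triangle.
by rewrite massoc_nat tensm_id.
Qed.

Lemma lunit_runit : lunit munit = runit (@munit V).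
Proof. by apply: runit_inj; rewrite -triangle -lunit_tens lunit_tensI. Qed.

Lemma lunit_assoc :
  (idm munit ⊠ lunit munit) ∘ massoc munit munit munit
  = lunit munit ⊠ idm (@munit V).
Proof. by rewrite triangle lunit_runit. Qed.

End MonoidalFacts.

Lemma sym_munit (V : symmetric_monoidal_category) :
  sym munit munit = idm (@munit V ⊗ munit).
Proof.
set s := sym _ _; pose l := lunit (@munit V).
pose lV := lunitV (@munit V); pose t := l ∘ s ∘ lV.
pose a := massoc munit munit (@munit V).
have lK : lV ∘ l = idm _ by apply: lunitK.
have lVK : l ∘ lV = idm _ by apply: lunitVK.
have linj X (f g : X ⟶ munit ⊗ munit) : l ∘ f = l ∘ g -> f = g.
  by move=> fg; rewrite -(cmp_idl f) -(cmp_idl g) -lK -!cmp_assoc fg.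
have tl : t ∘ l = l ∘ s by rewrite /t -!cmp_assoc lK cmp_idr.
have ts1 : t ⊠ idm munit = s.
  by apply: linj; rewrite -tl /l lunit_runit runit_nat.
have t1s : idm munit ⊠ t = s by apply: linj; rewrite -tl /l lunit_nat.
have triI : (idm munit ⊠ l) ∘ a = l ⊠ idm munit by apply: lunit_assoc.
have hex := hexagon munit munit (@munit V); rewrite -/a -/s in hex.
have ss : s ∘ (l ⊠ idm munit) = (s ∘ s) ∘ (l ⊠ idm munit).
  have := congr1 (fun f => (idm munit ⊠ l) ∘ f) hex.
  rewrite /= !cmp_assoc.
  rewrite triI -sym_nat -/s -(cmp_assoc s) triI => ->.
  rewrite -tensm_cmpr -tl tensm_cmpr t1s -(cmp_assoc s) triI.
  by rewrite -!cmp_assoc -tensm_cmpl -tl tensm_cmpl ts1.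
have {}ss : s = s ∘ s.
  have iso : (l ⊠ idm munit) ∘ (lV ⊠ idm munit) = idm _.
    by rewrite -tensm_cmpl lVK tensm_id.
  by rewrite -[LHS]cmp_idr -[RHS]cmp_idr -iso !cmp_assoc ss.
by rewrite ss symK.
Qed.

Lemma arity_cast_cst (C : category) (X : C) m n (e : m = n) :
  arity_cast (fun=> X) e = idm X.
Proof. by case: n / e. Qed.

Lemma arity_cast_nat (C : category) (O P : nat -> C)
    (f : forall n, O n ⟶ P n) m n (e : m = n) :
  f n ∘ arity_cast O e = arity_cast P e ∘ f m.
Proof. by case: n / e; rewrite /= cmp_idl cmp_idr. Qed.

Section UnitalAssociative.
Variable V : symmetric_monoidal_category.

Program Definition uAss : operad V :=
  @Operad V (fun=> munit) (idm munit) (fun p q i _ => lunit munit) _ _ _ _.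
Next Obligation.
move=> p r q i j ? ? ? ? e _ /=.
by rewrite arity_cast_cst cmp_idl sym_munit tensm_id cmp_idr -!cmp_assoc
     massocK cmp_idr.
Qed.
Next Obligation.
by move=> m p q i j ? ? ? e _ /=; rewrite arity_cast_cst cmp_idl -cmp_assoc lunit_assoc.
Qed.
Next Obligation.
by move=> n ? e /=; rewrite arity_cast_cst cmp_idl tensm_id cmp_idr.
Qed.
Next Obligation.
by move=> p i ? e /=; rewrite arity_cast_cst cmp_idl tensm_id cmp_idr lunit_runit.
Qed.

End UnitalAssociative.

Section Associative.
Variables (V : closed_symmetric_monoidal_category) (E : initial_object V).

Definition Ass_obj (n : nat) : V := if n is 0 then init E else munit.

Definition phi_map (n : nat) : Ass_obj n ⟶ munit :=
  match n with 0 => init_map E munit | _.+1 => idm munit end.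

Definition Ass_incl (m n : nat) : m <= n -> Ass_obj m ⟶ Ass_obj n :=
  match m, n return m <= n -> Ass_obj m ⟶ Ass_obj n with
  | 0, _ => fun=> init_map E _
  | _.+1, 0 => fun h => False_rect _ (notF h)
  | _.+1, _.+1 => fun=> idm munit
  end.

Lemma Ass_comp_subproof p q i : 1 <= i <= p -> q <= p + q - 1.
Proof. by lia. Qed.

(* For [q >= 1] this is the unit isomorphism of the tensor unit; for [q = 0] it
   is the only morphism out of the initial object [munit ⊗ init E]. This is the
   only choice compatible with [phi_map], see [Ass_comp_uniq]. *)
Definition Ass_comp (p q i : nat) (h : 1 <= i <= p) :
    Ass_obj p ⊗ Ass_obj q ⟶ Ass_obj (p + q - 1) :=
  Ass_incl (Ass_comp_subproof q h) ∘ lunit (Ass_obj q)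
  ∘ (phi_map p ⊠ idm (Ass_obj q)).

Definition initial (X : V) := forall Y (f g : X ⟶ Y), f = g.

Lemma initial_init : initial E.
Proof. by move=> Y f g; rewrite (init_uniq f) (init_uniq g). Qed.

Lemma initial_tensl X Y : initial X -> initial (X ⊗ Y).
Proof.
move=> iX Z f g; rewrite -(curryK f) -(curryK g).
by rewrite (iX _ (curry f) (curry g)).
Qed.

Lemma initial_tensr X Y : initial Y -> initial (X ⊗ Y).
Proof.
move=> iY Z f g; rewrite -(cmp_idr f) -(cmp_idr g) -(symK X Y) !cmp_assoc.
by congr cmp; apply: initial_tensl.
Qed.

Lemma phi_mono n : 0 < n -> forall X (f g : X ⟶ Ass_obj n),
  phi_map n ∘ f = phi_map n ∘ g -> f = g.
Proof. by case: n => // n _ X f g /=; rewrite !cmp_idl. Qed.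

Lemma phi_incl m n (h : m <= n) : phi_map n ∘ Ass_incl h = phi_map m.
Proof.
by case: m n h => [|m] [|n] h //=; rewrite ?cmp_idl //; apply: initial_init.
Qed.

Lemma phi_comp p q i (h : 1 <= i <= p) :
  phi_map (p + q - 1) ∘ Ass_comp q h
  = lunit munit ∘ (phi_map p ⊠ phi_map q).
Proof.
rewrite /Ass_comp !cmp_assoc phi_incl -lunit_nat -cmp_assoc -tensm_cmp.
by rewrite cmp_idl cmp_idr.
Qed.

Lemma Ass_comp_uniq p q i (h : 1 <= i <= p)
    (f : Ass_obj p ⊗ Ass_obj q ⟶ Ass_obj (p + q - 1)) :
  phi_map (p + q - 1) ∘ f = lunit munit ∘ (phi_map p ⊠ phi_map q) ->
  f = Ass_comp q h.
Proof.
case: q f => [|q] f phif.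
  by apply: initial_tensr; apply: initial_init.
by apply: phi_mono; [lia | rewrite phi_comp].
Qed.

Lemma phi_cast m n (e : m = n) : phi_map n ∘ arity_cast Ass_obj e = phi_map m.
Proof. by rewrite (arity_cast_nat phi_map) arity_cast_cst cmp_idl. Qed.

Lemma phi_comp_l p q r i j (h1 : 1 <= i <= p) (h2 : 1 <= j <= p + q - 1) :
  phi_map (p + q - 1 + r - 1) ∘ Ass_comp r h2 ∘ (Ass_comp q h1 ⊠ idm _)
  = lunit munit ∘ (lunit munit ⊠ idm munit)
    ∘ ((phi_map p ⊠ phi_map q) ⊠ phi_map r).
Proof.
rewrite phi_comp -!cmp_assoc; congr cmp.
by rewrite -!tensm_cmp phi_comp cmp_idr cmp_idl.
Qed.

Lemma phi_comp_r p q r i j (h1 : 1 <= i <= p) (h2 : 1 <= j <= q) :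
  phi_map (p + (q + r - 1) - 1) ∘ Ass_comp (q + r - 1) h1
    ∘ (idm _ ⊠ Ass_comp r h2)
  = lunit munit ∘ (idm munit ⊠ lunit munit)
    ∘ (phi_map p ⊠ (phi_map q ⊠ phi_map r)).
Proof.
rewrite phi_comp -!cmp_assoc; congr cmp.
by rewrite -!tensm_cmp phi_comp cmp_idr cmp_idl.
Qed.

Program Definition Ass : operad V :=
  @Operad V Ass_obj (idm munit) Ass_comp _ _ _ _.
Next Obligation.
move=> p r q i j h1 h2 h3 h4 e hij /=.
have [r0|r_gt0] := posnP r.
  by subst r; apply: initial_tensl; apply: initial_tensr; apply: initial_init.
have [q0|q_gt0] := posnP q.
  by subst q; apply: initial_tensr; apply: initial_init.
apply: phi_mono; first by lia.
move: Ass_comp phi_comp_l => K phi_Kl.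
rewrite !cmp_assoc phi_Kl phi_cast phi_Kl.
rewrite -!cmp_assoc; congr cmp; congr cmp.
rewrite -[LHS]cmp_idl -(massocK munit munit munit) -cmp_assoc massoc_nat.
rewrite -[X in _ = X]cmp_idl -(massocK munit munit munit) -[RHS]cmp_assoc.
congr cmp; rewrite (cmp_assoc (massoc _ _ _)) massoc_nat -!cmp_assoc.
rewrite (cmp_assoc (massoc _ _ _)) massocVK cmp_idl cmp_assoc; congr cmp.
by rewrite -tensm_cmp -sym_nat sym_munit cmp_idl cmp_idr.
Qed.
Next Obligation.
move=> m p q i j h1 h2 h3 e hij /=.
have [q0|q_gt0] := posnP q.
  by subst q; apply: initial_tensr; apply: initial_init.
apply: phi_mono; first by lia.
move: Ass_comp phi_comp_l phi_comp_r => K phi_Kl phi_Kr.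
rewrite !cmp_assoc phi_Kl phi_cast phi_Kr.
by rewrite -!cmp_assoc -massoc_nat (cmp_assoc (idm _ ⊠ _)) lunit_assoc.
Qed.
Next Obligation.
move=> n h e; have [n0|n_gt0] := posnP n.
  by subst n; apply: initial_tensr; apply: initial_init.
apply: phi_mono => //.
move: Ass_comp phi_comp => K phi_K.
by rewrite !cmp_assoc phi_cast phi_K tensm_id cmp_idr lunit_nat.
Qed.
Next Obligation.
move=> p i h e; have p_gt0 : 0 < p by lia.
apply: phi_mono => //.
move: Ass_comp phi_comp => K phi_K.
by rewrite !cmp_assoc phi_cast phi_K tensm_id cmp_idr lunit_runit runit_nat.
Qed.

Program Definition phi : hom (c := Op V) Ass (uAss V) :=
  @OperadHom V Ass (uAss V) phi_map _ _.
Next Obligation. by rewrite /= cmp_idl. Qed.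
Next Obligation. by move=> p q i h; rewrite /= phi_comp. Qed.

End Associative.

(* Main.v *)
From mathcomp Require Import all_boot.
Require Import Defs.

(** A two-sided unit of a binary operation is unique: if [u] and [u'] are both
    units of [m] then [u = m(u, u') = u'].  Let [g] and [h] be morphisms out of
    [uAss V] that agree after [phi E].  Since [phi E] is the identity in positive
    arities, [g] and [h] agree there, so they send the binary operation of
    [uAss V] to the same [m], while they send its constant to units [u] and [u']
    of [m].  The operadic form of [m(u, u')] is the parallel composition axiom
    [(m ∘_2 u') ∘_1 u = (m ∘_1 u) ∘_1 u'], whose sides are [u] and [u'] by the
    unit laws.  This is [uAss_hom_eq0], the only step with content.

    In an arbitrary [V] there are no elements, so the axiom is precomposed with
    [(h 2 ⊠ h 0) ⊠ g 0].  By [plug2] its two sides become [g 0] and [h 0], composed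
    with unit isomorphisms and, on one side, a permutation of tensor factors.  The
    same axiom inside [uAss V] says that the permutation is absorbed by the unit
    isomorphisms. *)

Set Implicit Arguments.
Unset Strict Implicit.
Unset Printing Implicit Defensive.
Local Open Scope cat_scope.

Lemma massocV_nat (V : monoidal_category) (A B C A' B' C' : V)
    (f : A ⟶ A') (g : B ⟶ B') (h : C ⟶ C') :
  massocV A' B' C' ∘ (f ⊠ (g ⊠ h)) = ((f ⊠ g) ⊠ h) ∘ massocV A B C.
Proof.
rewrite -[LHS]cmp_idr -(massocVK A B C) !cmp_assoc; congr cmp.
by rewrite -cmp_assoc -massoc_nat cmp_assoc massocK cmp_idl.
Qed.

Section SwapRight.
Variable V : symmetric_monoidal_category.

(** The permutation of the last two factors through which [ocomp_par] compares
    its two sides. *)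
Definition swapr (A B C : V) : A ⊗ B ⊗ C ⟶ A ⊗ C ⊗ B :=
  massocV A C B ∘ (idm A ⊠ sym B C) ∘ massoc A B C.

Lemma swapr_nat (A B C A' B' C' : V)
    (f : A ⟶ A') (g : B ⟶ B') (h : C ⟶ C') :
  swapr A' B' C' ∘ ((f ⊠ g) ⊠ h) = ((f ⊠ h) ⊠ g) ∘ swapr A B C.
Proof.
rewrite /swapr -!cmp_assoc massoc_nat (cmp_assoc (idm A' ⊠ _)) -tensm_cmp.
rewrite sym_nat cmp_idl -{1}(cmp_idr f) tensm_cmp !cmp_assoc.
by rewrite massocV_nat.
Qed.

End SwapRight.

Section MapsFromUnitalAssociative.
Variables (V : symmetric_monoidal_category) (P : operad V).
Notation I := (@munit V).

(** In [uAss V], filling either input of the binary operation with the constant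
    gives the operadic identity.  Hence the composite on the left plugs [k 0]
    into [f 1], that is into [k 1], and so it is [k 0] up to unit isomorphisms,
    whatever [i] is. *)
Lemma plug2 (f k : operad_hom (uAss V) P) (i : nat)
    (h1 : 1 <= 1 <= 1) (h2 : 1 <= i <= 2) :
  f 1 = k 1 ->
  (ocomp P (p := 1) 0 h1 ∘ (ocomp P 0 h2 ⊠ idm (P 0)))
    ∘ ((f 2 ⊠ f 0) ⊠ k 0)
  = k 0 ∘ (lunit I ∘ (lunit I ⊠ idm I)).
Proof.
move=> fk1; rewrite -cmp_assoc -tensm_cmp cmp_idl -(ohom_comp f).
rewrite -[k 0 in LHS]cmp_idr tensm_cmp !cmp_assoc.
have -> : f (2 + 0 - 1) = k 1 by [].
by rewrite -(ohom_comp k).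
Qed.

(** Uniqueness of the unit of a binary operation, with [g 0] and [h 0] as the
    two units of [g 2 = h 2]. *)
Lemma uAss_hom_eq0 (g h : operad_hom (uAss V) P) :
  g 1 = h 1 -> g 2 = h 2 -> g 0 = h 0.
Proof.
move=> gh1 gh2.
have h11 : 1 <= 1 <= 1 by [].
have h12 : 1 <= 1 <= 2 by [].
have h22 : 1 <= 2 <= 2 by [].
(* The arities [2 + 0 - 1] and [1 + 0 - 1] compute, so the cast is along a
   reflexivity proof. *)
have par (Q : operad V) :
    ocomp Q (p := 1) 0 h11 ∘ (ocomp Q 0 h22 ⊠ idm (Q 0))
    = ocomp Q (p := 1) 0 h11 ∘ (ocomp Q 0 h12 ⊠ idm (Q 0)) ∘ swapr _ _ _.
  have := @ocomp_par V Q 2 0 0 2 1 h22 h11 h12 h11 erefl isT.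
  by rewrite /swapr /= cmp_idl !cmp_assoc.
have eqP : g 0 ∘ (lunit I ∘ (lunit I ⊠ idm I))
         = h 0 ∘ (lunit I ∘ (lunit I ⊠ idm I)).
  rewrite -(plug2 h11 h22 (esym gh1)) par -cmp_assoc swapr_nat -gh2 cmp_assoc.
  rewrite (plug2 h11 h12 gh1) -cmp_assoc; congr cmp.
  exact: esym (par (uAss V)).
have lK : lunit I ∘ (lunit I ⊠ idm I) ∘ ((lunitV I ⊠ idm I) ∘ lunitV I) = idm I.
  rewrite -cmp_assoc (cmp_assoc (lunit I ⊠ _)) -tensm_cmpl lunitVK tensm_id.
  by rewrite cmp_idl lunitVK.
by rewrite -[LHS]cmp_idr -[RHS]cmp_idr -lK !(cmp_assoc _ _ ((_ ⊠ _) ∘ _)) eqP.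
Qed.

End MapsFromUnitalAssociative.

Theorem proposition1p1 (V : closed_symmetric_monoidal_category)
    (E : initial_object V) : epimorphism (phi E).
Proof.
move=> P g h gh; apply: operad_hom_eq.
have ghS n : g n.+1 = h n.+1.
  have := congr1 (fun k : operad_hom (Ass E) P => k n.+1) gh.
  by rewrite /= !cmp_idr.
by case=> [|n]; [apply: uAss_hom_eq0 | apply: ghS].
Qed.
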